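(* Let $n\ge2$, let $L_n$ be the lattice of arithmetic progressions in $[n]$, and let $\Delta_n$ be the order complex of $L_n\setminus\{\emptyset,[n]\}$. If $n-1$ is not squarefree, then $\Delta_n$ is contractible. Otherwise, $\Delta_n$ has the homotopy type of the sphere $S^k$, where $k$ is the number of distinct primes dividing $n-1$.
   Context: $L_n$ is the set of all subsets of $[n]=\{1,\ldots,n\}$ that are arithmetic progressions $\{a,a+r,\ldots,a+(k-1)r\}$ ($a$, $r\ge1$, $k\ge0$ integers; including $\emptyset$, singletons and $2$-element subsets), ordered by inclusion. The order complex of a poset $P$ is the simplicial complex with vertex set $P$ whose faces are the chains of $P$; topological statements refer to its geometric realisation. *)

(* Defs.v *)
From HB Require Import structures.
From mathcomp Require Import all_boot all_order all_algebra.
From mathcomp Require Import all_classical all_reals all_analysis.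

Set Implicit Arguments.
Unset Strict Implicit.
Unset Printing Implicit Defensive.

Import Order.TTheory GRing.Theory Num.Theory.
Import numFieldNormedType.Exports.

Local Open Scope classical_set_scope.
Local Open Scope ring_scope.

Definition squarefree (m : nat) : Prop :=
  forall d : nat, (d ^ 2 %| m)%N -> d = 1%N.

(* The ordinal i : 'I_n stands for the element i.+1 of [n] = {1, ..., n}.  The
   equivalence ranges over all m : nat, so that the whole progression
   a, a + r, ..., a + (k - 1) r is required to lie in [n]. *)
Definition is_arith_prog (n : nat) (S : {set 'I_n}) : Prop :=
  exists a r k : nat, (1 <= r)%N /\
    forall m : nat, (exists2 i : 'I_n, i \in S & i.+1 = m) <->
                    (exists2 j : nat, (j < k)%N & m = (a + j * r)%N).

Definition arith_progs (n : nat) : {set {set 'I_n}} :=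
  [set S : {set 'I_n} | `[< is_arith_prog S >]]%SET.

Definition proper_arith_progs (n : nat) : {set {set 'I_n}} :=
  (arith_progs n :\: [set finset.set0; finset.setT])%SET.

(* The order complex of P ordered by le; a complex is given by its set of faces
   (the empty one included). *)
Definition order_complex (T : finType) (le : rel T) (P : {set T}) :
    {set {set T}} :=
  [set C : {set T} | (C \subset P) &&
     [forall x in C, forall y in C, le x y || le y x]]%SET.

(* Barycentric coordinates; the vertices form a finite type, so the topology
   induced from the product space R^V is that of the geometric realisation. *)
Definition realisation_set (R : realType) (V : finType) (K : {set {set V}}) :
    set {ptws V -> R} :=
  [set x | [/\ forall v, 0 <= x v, \sum_v x v = 1 &
               finset (fun v => x v != 0) \in K]].

Definition realisation (R : realType) (V : finType) (K : {set {set V}}) :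
    topologicalType :=
  set_type (@realisation_set R V K).

Definition Delta (n : nat) : {set {set {set 'I_n}}} :=
  order_complex (fun A B : {set 'I_n} => A \subset B) (proper_arith_progs n).

Definition sphere (R : realType) (k : nat) : topologicalType :=
  set_type [set x : 'rV[R]_k.+1 | \sum_(i < k.+1) x ord0 i ^+ 2 = 1].

Definition homotopic (R : realType) (X Y : topologicalType) (f g : X -> Y) :
    Prop :=
  exists H : X * R -> Y,
    [/\ {within [set: X] `*` `[0, 1], continuous H},
        forall x, H (x, 0) = f x & forall x, H (x, 1) = g x].

Definition homotopy_equivalent (R : realType) (X Y : topologicalType) : Prop :=
  exists (f : X -> Y) (g : Y -> X),
    [/\ continuous f, continuous g,
        homotopic R (g \o f) idfun & homotopic R (f \o g) idfun].

Definition contractible (R : realType) (X : topologicalType) : Prop :=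
  exists x0 : X, homotopic R idfun (fun _ : X => x0).

(* Main.v *)
(* Every proper progression lies in a coatom of L_n: [n] minus {n}, [n] minus
   {1}, or A_p = {1, 1 + p, ..., n} for a prime p dividing n - 1.  Sending v to
   cl v, the meet of the coatoms above v, is monotone with v <= cl v.  If n - 1
   is not squarefree, the meet M of all coatoms is nonempty, and
   v <= cl v >= M contracts Delta_n.  If n - 1 is squarefree, the k + 2 coatoms
   have empty meet but every proper subfamily has a nonempty one, so the closed
   elements form the proper part of a Boolean lattice of rank k + 2, whose order
   complex is a k-sphere.

   This last equivalence is given by explicit maps.  A point x of |Delta_n| has
   the masses y_c = sum of x_v over v <= c, one for each coatom c; they are not
   all equal, so y defines a nonzero vector in R^(k+2) modulo the diagonal,
   hence a point of S^k.  Conversely a nonconstant y is sent to the normalised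
   sum over subsets S of coatoms of prod_(a in S, b notin S) (y_a - y_b)^+ times
   the meet of S: the sets S with a nonzero coefficient are upper level sets of
   y, hence form a chain. *)
Require Import Defs.
From mathcomp Require Import all_boot all_order all_algebra.
From mathcomp Require Import all_classical all_reals all_analysis.
From mathcomp Require Import ring lra zify.

Import Order.TTheory GRing.Theory Num.Theory.
Import numFieldNormedType.Exports.

Section Crosscut.
Set Implicit Arguments.
Unset Strict Implicit.
Unset Printing Implicit Defensive.
Local Open Scope classical_set_scope.
Local Open Scope ring_scope.

(** * Homotopies *)

Lemma continuousT_pair (X Y Z : topologicalType) (f : X -> Y) (g : X -> Z) :
  continuous f -> continuous g -> continuous (fun x => (f x, g x)).
Proof. by move=> cf cg x; apply: cvg_pair; [exact: cf | exact: cg]. Qed.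

Lemma continuousT_fst (X Y : topologicalType) :
  continuous (fun p : X * Y => p.1).
Proof. by move=> p; exact: cvg_fst. Qed.

Lemma continuousT_snd (X Y : topologicalType) :
  continuous (fun p : X * Y => p.2).
Proof. by move=> p; exact: cvg_snd. Qed.

Lemma continuousT_comp (X Y Z : topologicalType) (f : X -> Y) (g : Y -> Z) :
  continuous f -> continuous g -> continuous (fun x => g (f x)).
Proof. by move=> cf cg x; exact: continuous_comp (cf x) (cg (f x)). Qed.

Lemma continuous_sum (R : realType) (X : topologicalType) (I : finType)
    (P : pred I) (F : I -> X -> R) :
  (forall i, P i -> continuous (F i)) ->
  continuous (fun x => \sum_(i | P i) F i x).
Proof. by move=> cF; apply: continuous_big => //; exact: add_continuous. Qed.

Lemma continuous_prod (R : realType) (X : topologicalType) (I : finType)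
    (P : pred I) (F : I -> X -> R) :
  (forall i, P i -> continuous (F i)) ->
  continuous (fun x => \prod_(i | P i) F i x).
Proof. by move=> cF; apply: continuous_big => //; exact: mul_continuous. Qed.

Lemma continuous_minr (R : realType) (X : topologicalType) (f g : X -> R) :
  continuous f -> continuous g -> continuous (fun x => Num.min (f x) (g x)).
Proof. by move=> cf cg x; exact: continuous_min (cf x) (cg x). Qed.

Lemma continuous_maxr (R : realType) (X : topologicalType) (f g : X -> R) :
  continuous f -> continuous g -> continuous (fun x => Num.max (f x) (g x)).
Proof. by move=> cf cg x; exact: continuous_max (cf x) (cg x). Qed.

Lemma continuous_set_type (X Y : topologicalType) (A : set Y)
    (f : X -> set_type A) :
  continuous (fun x => \val (f x)) -> continuous f.
Proof. by move=> cf; apply: continuous_comp_initial. Qed.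

Lemma set_val_continuous (Y : topologicalType) (A : set Y) :
  continuous (fun x : set_type A => \val x).
Proof. exact: initial_continuous. Qed.

Lemma realisation_coord_continuous (R : realType) (V : finType)
    (K : {set {set V}}) (v : V) :
  continuous (fun x : realisation R K => \val x v).
Proof.
have cval : continuous (fun x : realisation R K => (\val x : {ptws V -> R})).
  exact: set_val_continuous.
exact: continuousT_comp cval (@proj_continuous V (fun=> R) v).
Qed.

Lemma continuous_realisation (R : realType) (X : topologicalType)
    (V : finType) (K : {set {set V}}) (f : X -> realisation R K) :
  (forall v, continuous (fun x => \val (f x) v)) -> continuous f.
Proof.
move=> cf; apply: continuous_set_type => x.
apply/(@pointwise_cvgP (discrete_topology V) R) => v; exact: cf.
Qed.

Lemma sphere_coord_continuous (R : realType) (k : nat) (i : 'I_k.+1) :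
  continuous (fun x : sphere R k => \val x ord0 i).
Proof.
have cval : continuous (fun x : sphere R k => (\val x : 'rV[R]_k.+1)).
  exact: set_val_continuous.
exact: continuousT_comp cval (@coord_continuous R 1 k.+1 ord0 i).
Qed.

Lemma continuous_sphere (R : realType) (X : topologicalType) (k : nat)
    (f : X -> sphere R k) :
  (forall i, continuous (fun x => \val (f x) ord0 i)) -> continuous f.
Proof.
(* A neighbourhood in the matrix topology contains a box [P] given entry by entry; the entries being
   finitely many, the preimages of its sides meet in a neighbourhood. *)
move=> cf; apply: continuous_set_type => x U /= [P Pf sPU].
apply: (filterS (P := [set y | forall i j, P i j (\val (f y) i j)])).
  by move=> y Py; apply: sPU.
have H : forall ij : 'I_1 * 'I_k.+1, nbhs x
    [set y | P ij.1 ij.2 (\val (f y) ij.1 ij.2)].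
  by case=> i j /=; move: (Pf i j); rewrite (ord1 i); exact: cf.
apply: filterS (filter_forall _ H) => y Hy i j; exact: (Hy (i, j)).
Qed.

Lemma continuous_homotopic (R : realType) (X Y : topologicalType)
    (H : X * R -> Y) :
  continuous H -> homotopic R (fun x => H (x, 0)) (fun x => H (x, 1)).
Proof. by move=> cH; exists H; split => //; exact: continuous_subspaceT cH. Qed.

(** The retraction of the line onto [0, 1]; it turns a formula valid only for times in [0, 1] into
    one defined at all times. *)
Definition clamp (R : realType) (t : R) : R := Num.max 0 (Num.min 1 t).

Lemma clamp_itv (R : realType) (t : R) : 0 <= clamp t <= 1.
Proof. by rewrite /clamp le_max lexx ge_max ler01 ge_min lexx. Qed.

Lemma clamp_le0 (R : realType) (t : R) : t <= 0 -> clamp t = 0.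
Proof. by move=> t0; rewrite /clamp max_l // ge_min t0 orbT. Qed.

Lemma clamp_ge1 (R : realType) (t : R) : 1 <= t -> clamp t = 1.
Proof. by move=> t1; rewrite /clamp min_l // max_r. Qed.

Lemma clamp_continuous (R : realType) : continuous (@clamp R).
Proof.
apply: continuous_maxr; first by move=> ?; exact: cvg_cst.
by apply: continuous_minr; [move=> ?; exact: cvg_cst | move=> ?; exact: cvg_id].
Qed.

(* Freezing a homotopy outside [0, 1] makes it continuous on X * R. *)
Lemma homotopicP (R : realType) (X Y : topologicalType) (f g : X -> Y) :
  homotopic R f g -> exists H : X * R -> Y,
    [/\ continuous H, forall x t, t <= 0 -> H (x, t) = f x &
        forall x t, 1 <= t -> H (x, t) = g x].
Proof.
move=> [H [cH H0 H1]]; pose q (p : X * R) := (p.1, clamp p.2).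
have cq : continuous q.
  apply: continuousT_pair; first exact: continuousT_fst.
  exact: continuousT_comp (@continuousT_snd X R) (@clamp_continuous R).
exists (fun p => H (q p)); split.
- move: cH => /subspace_continuousP cH p U /= HU.
  have qA p' : ([set: X] `*` `[0, 1]) (q p').
    by split => //=; rewrite in_itv /= clamp_itv.
  (* Relative continuity controls [H] only on the cylinder, but [q] always lands there. *)
  have near_q : nbhs p [set p' | ([set: X] `*` `[0, 1]) (q p') -> U (H (q p'))].
    exact: cq p _ (cH (q p) (qA p) U HU).
  by apply: (filterS _ near_q) => p' /(_ (qA p')).
- by move=> x t t0; rewrite /q /= clamp_le0.
- by move=> x t t0; rewrite /q /= clamp_ge1.
Qed.

Lemma homotopic_sym (R : realType) (X Y : topologicalType) (f g : X -> Y) :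
  homotopic R f g -> homotopic R g f.
Proof.
move=> /homotopicP[H [cH H0 H1]].
exists (fun p => H (p.1, 1 - p.2)); split => /=.
- have cflip : continuous (fun p : X * R => 1 - p.2).
    by move=> p; apply: cvgB; [exact: cvg_cst | exact: cvg_snd].
  have cpair := continuousT_pair (@continuousT_fst X R) cflip.
  exact: continuous_subspaceT (continuousT_comp cpair cH).
- by move=> x; rewrite H1 //; lra.
- by move=> x; rewrite H0 //; lra.
Qed.

Lemma homotopic_trans (R : realType) (X Y : topologicalType)
    (f g h : X -> Y) :
  homotopic R f g -> homotopic R g h -> homotopic R f h.
Proof.
move=> /homotopicP[F [cF F0 F1]] /homotopicP[G [cG G0 G1]].
pose K (p : X * R) := if p.2 <= 1 / 2 then F (p.1, 2 * p.2)
                       else G (p.1, 2 * p.2 - 1).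
have caff c : continuous (fun p : X * R => (p.1, 2 * p.2 - c)).
  apply: continuousT_pair; [exact: continuousT_fst | move=> p].
  by apply: cvgB; [apply: cvgM; [exact: cvg_cst | exact: cvg_snd]
                  | exact: cvg_cst].
have cK : continuous K.
  apply/continuous_subspace_setT.
  rewrite (_ : setT = [set p : X * R | p.2 <= 1/2] `|` [set p | 1/2 <= p.2]);
    last first.
    apply/seteqP; split => // p _ /=.
    by case: (leP p.2 (1/2)); [left | right; lra].
  apply: withinU_continuous.
  - exact: (preimage_closed (fun p _ => @continuousT_snd X R p)
      (@closed_le R (1/2))).
  - exact: (preimage_closed (fun p _ => @continuousT_snd X R p)
      (@closed_ge R (1/2))).
  - apply: (@subspace_eq_continuous (X * R)%type [set p | p.2 <= 1/2] Y
      (fun p => F (p.1, 2 * p.2 - 0)) K).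
      by move=> p; rewrite inE /= /K => ->; rewrite subr0.
    exact: continuous_subspaceT (continuousT_comp (caff 0) cF).
  - apply: (@subspace_eq_continuous (X * R)%type [set p | 1/2 <= p.2] Y
      (fun p => G (p.1, 2 * p.2 - 1)) K).
      (* The two closed halves overlap only at time 1/2, where [F] has ended and [G] begins: both
         give [g]. *)
      move=> p; rewrite inE /= /K => p2; case: ifP => // p2'.
      by rewrite G0 ?F1 //; lra.
    exact: continuous_subspaceT (continuousT_comp (caff 1) cG).
exists K; split; first exact: continuous_subspaceT cK.
- by move=> x; rewrite /K /= (_ : 0 <= 1 / 2) ?F0 //; lra.
- by move=> x; rewrite /K /= (_ : 1 <= 1 / 2 = false) ?G1 //; lra.
Qed.

Lemma continuousT_sub (R : realType) (X : topologicalType) (f g : X -> R) :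
  continuous f -> continuous g -> continuous (fun x => f x - g x).
Proof. by move=> cf cg x; apply: cvgB; [exact: cf | exact: cg]. Qed.

Lemma continuousT_cst (R : realType) (X : topologicalType) (c : R) :
  continuous (fun _ : X => c).
Proof. by move=> x; exact: cvg_cst. Qed.

Lemma continuousT_div (R : realType) (X : topologicalType) (f g : X -> R) :
  (forall x, g x != 0) -> continuous f -> continuous g ->
  continuous (fun x => f x / g x).
Proof.
move=> g0 cf cg x; apply: cvgM; first exact: cf.
by apply: cvgV; [exact: g0 | exact: cg].
Qed.

(** * Maps between order complexes *)

Lemma order_complexP (R : realType) (T : finType) (le : rel T) (P : {set T})
    (x : {ptws T -> R}) :
  realisation_set (order_complex le P) x <->
  [/\ forall v, 0 <= x v, \sum_v x v = 1, forall v, x v != 0 -> v \in P &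
      forall u v, x u != 0 -> x v != 0 -> le u v || le v u].
Proof.
split=> [[x0 x1]|[x0 x1 xP xle]].
  rewrite inE => /andP[/fintype.subsetP xP /forall_inP xle]; split => //.
    by move=> v xv; apply: xP; rewrite inE.
  move=> u v xu xv; have : u \in finset (fun v => x v != 0) by rewrite inE.
  by move/xle/forall_inP; apply; rewrite inE.
split => //; rewrite inE; apply/andP; split.
  by apply/fintype.subsetP => v; rewrite inE; exact: xP.
apply/forall_inP => u; rewrite inE => xu.
by apply/forall_inP => v; rewrite inE; exact: xle.
Qed.

Definition realisation_point (R : realType) (V : finType) (K : {set {set V}})
    (x : {ptws V -> R}) (Kx : realisation_set K x) : realisation R K :=
  exist _ x (mem_set Kx).

(** For [J] a vertex set, this is the simplicial map induced by [m] in barycentric coordinates. A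
    general [J] allows sums of weighted vertices with repetitions. *)
Definition pushforward (R : realType) (J V : finType) (m : J -> V)
    (w : J -> R) : {ptws V -> R} := fun v => \sum_(j | m j == v) w j.

Lemma pushforward_neq0 (R : realType) (J V : finType) (m : J -> V)
    (w : J -> R) (v : V) :
  pushforward m w v != 0 -> exists2 j, w j != 0 & m j = v.
Proof.
move=> wv; apply/exists2P/not_existsP => nj; case/eqP: wv.
rewrite /pushforward big1 // => j /eqP mj; apply/eqP.
by apply: contraT => wj; case: (nj j).
Qed.

Lemma pushforward_realisation (R : realType) (J T : finType) (le : rel T)
    (P : {set T}) (m : J -> T) (w : J -> R) :
  (forall j, 0 <= w j) -> \sum_j w j = 1 ->
  (forall j, w j != 0 -> m j \in P) ->
  (forall i j, w i != 0 -> w j != 0 -> le (m i) (m j) || le (m j) (m i)) ->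
  realisation_set (order_complex le P) (pushforward m w).
Proof.
move=> w0 w1 wP wle; apply/order_complexP; split.
- by move=> v; apply: sumr_ge0 => j _.
- rewrite -w1 (partition_big m predT) //=.
- by move=> v /pushforward_neq0[j wj <-]; exact: wP.
- move=> u v /pushforward_neq0[i wi <-] /pushforward_neq0[j wj <-].
  exact: wle.
Qed.

Definition below (R : realType) (T : finType) (le : rel T) (x : T -> R)
    (v : T) : R := \sum_(u | le u v && (u != v)) x u.

(* Spread the mass of a chain over the interval [0, 1], smaller elements first:
   an element v of the support occupies ]below v, below v + x v], of which
   initial_mass keeps the part lying in ]0, t]. *)
Definition initial_mass (R : realType) (T : finType) (le : rel T) (x : T -> R)
    (t : R) (v : T) : R :=
  Num.min (below le x v + x v) t - Num.min (below le x v) t.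

Section OrderHomotopy.
Variables (R : realType) (T U : finType) (leT : rel T) (leU : rel U).
Hypothesis leT_anti : antisymmetric leT.
Hypothesis leT_trans : transitive leT.

Lemma initial_mass_ge0 (x : T -> R) t v : 0 <= x v ->
  0 <= initial_mass leT x t v.
Proof. by move=> xv; rewrite subr_ge0 le_min2 // lerDl. Qed.

Lemma initial_mass_le (x : T -> R) t v : 0 <= x v ->
  initial_mass leT x t v <= x v.
Proof.
rewrite /initial_mass => xv.
by case: (leP (_ + _) t); case: (leP (below _ _ _) t); lra.
Qed.

Lemma initial_mass_eq0 (x : T -> R) t v : 0 <= x v -> t <= below leT x v ->
  initial_mass leT x t v = 0.
Proof. by move=> xv tv; rewrite /initial_mass !min_r ?subrr //; lra. Qed.

Lemma initial_mass_full (x : T -> R) t v : 0 <= x v ->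
  below leT x v + x v <= t -> initial_mass leT x t v = x v.
Proof. by move=> xv tv; rewrite /initial_mass !min_l //; lra. Qed.

(** The elements strictly below [u], and [u] itself, all lie strictly below [v]; antisymmetry keeps
    [v] from being one of them. *)
Lemma below_lt (x : T -> R) u v : (forall v, 0 <= x v) ->
  leT u v -> u != v -> below leT x u + x u <= below leT x v.
Proof.
move=> x0 uv neq_uv; rewrite [leRHS](bigD1 u) /= ?uv //.
  rewrite [leLHS]addrC lerD2l.
rewrite /below big_mkcond [leRHS]big_mkcond ler_sum // => w _.
case: ifPn => [/andP[wu neq_wu]|_]; last by case: ifP.
rewrite (leT_trans wu uv) neq_wu andbT /= ifT //.
apply: contraNneq neq_uv => wv; rewrite -wv in uv *.
by rewrite (leT_anti (x := w) (y := u)) ?wu ?uv.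
Qed.

Lemma below_ge0 (x : T -> R) v : (forall v, 0 <= x v) -> 0 <= below leT x v.
Proof. by move=> x0; apply: sumr_ge0. Qed.

Lemma below_le_sum (x : T -> R) v : (forall v, 0 <= x v) ->
  below leT x v + x v <= \sum_u x u.
Proof.
move=> x0; rewrite [leRHS](bigD1 v) //= [leLHS]addrC lerD2l.
rewrite /below big_mkcond [leRHS]big_mkcond ler_sum // => u _.
by rewrite andbC; case: (u != v) => //=; case: ifP.
Qed.

Variables (P : {set T}) (Q : {set U}).

(* The straight line from |f| to |g| may leave the complex: for u < v, nothing
   makes g u and f v comparable.  Moving the mass to g from the top of the chain
   downwards avoids this, as f u <= g v whenever u <= v. *)
Lemma order_homotopic (f g : T -> U)
    (F G : realisation R (order_complex leT P) ->
           realisation R (order_complex leU Q)) :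
  transitive leU ->
  {in P, forall v, f v \in Q} -> {in P, forall v, g v \in Q} ->
  {in P &, {homo f : u v / leT u v >-> leU u v}} ->
  {in P &, {homo g : u v / leT u v >-> leU u v}} ->
  {in P, forall v, leU (f v) (g v)} ->
  (forall x, \val (F x) = pushforward f (\val x)) ->
  (forall x, \val (G x) = pushforward g (\val x)) ->
  homotopic R F G.
Proof.
move=> leU_trans fQ gQ f_homo g_homo fg Ff Gg.
(* Each vertex is doubled: the left copy sends the part of its mass in ]0, t] to [f], the right copy
   sends the rest to [g]. *)
pose m (j : T + T) := match j with inl v => f v | inr v => g v end.
pose w (x : T -> R) t (j : T + T) := match j with
  | inl v => initial_mass leT x t v
  | inr v => x v - initial_mass leT x t v end.
have Hmem (x : realisation R (order_complex leT P)) t :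
    realisation_set (order_complex leU Q) (pushforward m (w (\val x) t)).
  have [x0 x1 xP xle] := (order_complexP _ _ _).1 (set_mem (svalP x)).
  have wx v j : w (sval x) t j != 0 -> j = inl v \/ j = inr v -> sval x v != 0.
    move=> /[swap] ij; apply: contraNneq => xv.
    have := initial_mass_ge0 t (x0 v); have := initial_mass_le t (x0 v).
    by case: ij => -> /=; lra.
  apply: pushforward_realisation.
  - move=> [v|v] /=; first exact: initial_mass_ge0.
    by rewrite subr_ge0 initial_mass_le.
  - by rewrite big_sumType /= -big_split /= -x1; apply: eq_bigr => v _; lra.
  - by move=> [v|v] /wx => /(_ v) xv; [apply: fQ|apply: gQ]; apply/xP/xv; auto.
  (* If [v] were strictly below [u], the interval of [v] would end before that of [u] starts; but
     mass left at [f u] puts [t] after the start of the latter, and mass moved to [g v] puts [t]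
     before the end of the former. *)
  - have mixed u v : w (sval x) t (inl u) != 0 -> w (sval x) t (inr v) != 0 ->
        leU (f u) (g v).
      move=> wu wv; have xu := wx u _ wu (or_introl erefl).
      have xv := wx v _ wv (or_intror erefl).
      have [<-|neq_vu] := eqVneq v u; first by apply/fg/xP.
      have /orP[uv|vu] := xle _ _ xu xv.
        by apply: (@leU_trans (f v)); [apply: f_homo|apply: fg]; rewrite ?xP.
      have bvu := below_lt x0 vu neq_vu.
      have tu : below leT (sval x) u < t.
        rewrite ltNge; apply: contra wu => tu /=.
        by rewrite initial_mass_eq0.
      have tv : t < below leT (sval x) v + sval x v.
        rewrite ltNge; apply: contra wv => tv /=.
        by rewrite initial_mass_full // subrr.
      lra.
    move=> [u|u] [v|v] wu wv.
    + have xu := wx u _ wu (or_introl erefl).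
      have xv := wx v _ wv (or_introl erefl).
      by have /orP[uv|vu] := xle _ _ xu xv; apply/orP; [left|right];
        apply: f_homo; rewrite ?xP.
    + by rewrite /= mixed.
    + by rewrite /= (mixed v u) // orbT.
    + have xu := wx u _ wu (or_intror erefl).
      have xv := wx v _ wv (or_intror erefl).
      by have /orP[uv|vu] := xle _ _ xu xv; apply/orP; [left|right];
        apply: g_homo; rewrite ?xP.
(* At parameter 1 all the mass sits at [f], so time is reversed. *)
pose H (p : realisation R (order_complex leT P) * R) :=
  realisation_point (Hmem p.1 (1 - p.2)).
have cH : continuous H.
  have ccoord v : continuous (fun p : realisation R (order_complex leT P) * R =>
      \val p.1 v).
    exact: continuousT_comp (@continuousT_fst _ _)
      (@realisation_coord_continuous _ _ _ _).
  have ctime : continuous (fun p : realisation R (order_complex leT P) * R =>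
      1 - p.2).
    move=> p; apply: cvgB; [exact: cvg_cst | exact: continuousT_snd].
  have cbelow v : continuous (fun p : realisation R (order_complex leT P) * R =>
      below leT (\val p.1) v).
    by apply: continuous_sum => u _; exact: ccoord.
  have cmass v : continuous (fun p : realisation R (order_complex leT P) * R =>
      initial_mass leT (\val p.1) (1 - p.2) v).
    move=> p; apply: cvgB.
      apply: continuous_minr p; last exact: ctime.
      by move=> p; apply: cvgD; [exact: cbelow | exact: ccoord].
    exact: continuous_minr (@cbelow v) ctime p.
  apply: continuous_realisation => v; apply: continuous_sum => -[u|u] _.
    exact: cmass.
  by move=> p; apply: cvgB; [exact: ccoord | exact: cmass].
have -> : F = fun x => H (x, 0).
  apply/funext => x; apply/val_inj; rewrite Ff /=; apply/funext => v.
  have [x0 x1 xP xle] := (order_complexP _ _ _).1 (set_mem (svalP x)).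
  rewrite /pushforward big_sumType /= subr0 [X in _ + X]big1 ?addr0 => [|u _].
    apply: eq_bigr => u _; rewrite initial_mass_full // -x1.
    exact: below_le_sum.
  by rewrite initial_mass_full ?subrr // -x1; exact: below_le_sum.
have -> : G = fun x => H (x, 1).
  apply/funext => x; apply/val_inj; rewrite Gg /=; apply/funext => v.
  have [x0 x1 xP xle] := (order_complexP _ _ _).1 (set_mem (svalP x)).
  rewrite /pushforward big_sumType /= subrr [X in X + _]big1 ?add0r => [|u _].
    apply: eq_bigr => u _; rewrite initial_mass_eq0 ?subr0 //.
    exact: below_ge0.
  by rewrite initial_mass_eq0 //; exact: below_ge0.
exact: continuous_homotopic cH.
Qed.

End OrderHomotopy.

(** The supports of [F x] and [G x] together form a chain, so the segment between the two points
    stays in one simplex. *)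
Lemma straight_line_homotopic (R : realType) (X : topologicalType)
    (T : finType) (le : rel T) (P : {set T})
    (F G : X -> realisation R (order_complex le P)) :
  continuous F -> continuous G ->
  (forall x u v, \val (F x) u != 0 -> \val (G x) v != 0 -> le u v || le v u) ->
  homotopic R F G.
Proof.
move=> cF cG FG.
have Hmem (x : X) (t : R) : 0 <= t <= 1 -> realisation_set (order_complex le P)
    (fun v => (1 - t) * \val (F x) v + t * \val (G x) v).
  move=> t01.
  have [f0 f1 fP fle] := (order_complexP _ _ _).1 (set_mem (svalP (F x))).
  have [g0 g1 gP gle] := (order_complexP _ _ _).1 (set_mem (svalP (G x))).
  have supp v : (1 - t) * sval (F x) v + t * sval (G x) v != 0 ->
      sval (F x) v != 0 \/ sval (G x) v != 0.
    have [->|] := eqVneq (sval (F x) v) 0; last by left.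
    have [->|] := eqVneq (sval (G x) v) 0; last by right.
    by rewrite !mulr0 addr0 eqxx.
  apply/order_complexP; split.
  - by move=> v /=; have := f0 v; have := g0 v; nra.
  - by rewrite big_split /= -!mulr_sumr f1 g1; lra.
  - by move=> v /supp[/fP|/gP].
  - move=> u v /supp[xu|xu] /supp[xv|xv].
    + exact: fle.
    + exact: FG xu xv.
    + by rewrite orbC; exact: FG xv xu.
    + exact: gle.
pose H (p : X * R) := realisation_point (Hmem p.1 _ (clamp_itv p.2)).
have cH : continuous H.
  apply: continuous_realisation => v.
  have cl : continuous (fun p : X * R => clamp p.2).
    exact: continuousT_comp (@continuousT_snd X R) (@clamp_continuous R).
  have cFv := continuousT_comp (continuousT_comp (@continuousT_fst X R) cF)
    (@realisation_coord_continuous _ _ _ v).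
  have cGv := continuousT_comp (continuousT_comp (@continuousT_fst X R) cG)
    (@realisation_coord_continuous _ _ _ v).
  move=> p; apply: cvgD; apply: cvgM; [|exact: cFv|exact: cl|exact: cGv].
  by apply: cvgB; [exact: cvg_cst | exact: cl].
have -> : F = fun x => H (x, 0).
  apply/funext => x; apply/val_inj/funext => v /=.
  by rewrite clamp_le0 // subr0 mul1r mul0r addr0.
have -> : G = fun x => H (x, 1).
  apply/funext => x; apply/val_inj/funext => v /=.
  by rewrite clamp_ge1 // subrr mul1r mul0r add0r.
exact: continuous_homotopic cH.
Qed.

Lemma pushforward_monotone (R : realType) (T U : finType) (leT : rel T)
    (leU : rel U) (P : {set T}) (Q : {set U}) (f : T -> U) :
  {in P, forall v, f v \in Q} ->
  {in P &, {homo f : u v / leT u v >-> leU u v}} ->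
  forall x : realisation R (order_complex leT P),
  realisation_set (order_complex leU Q) (pushforward f (\val x)).
Proof.
move=> fQ f_homo x.
have [x0 x1 xP xle] := (order_complexP _ _ _).1 (set_mem (svalP x)).
apply: pushforward_realisation => //; first by move=> v /xP; exact: fQ.
by move=> u v xu xv; have /orP[uv|vu] := xle _ _ xu xv; apply/orP;
  [left|right]; apply: f_homo => //; exact: xP.
Qed.

Lemma realisation_support (R : realType) (V : finType) (K : {set {set V}})
    (x : realisation R K) : exists v, \val x v != 0.
Proof.
have [_ x1 _] := set_mem (svalP x); apply/not_existsP => x0.
have := oner_neq0 R; rewrite -x1 big1 ?eqxx // => v _; apply/eqP.
by apply: contraT => xv; case: (x0 v).
Qed.

(** Two order homotopies, from the identity up to [cl] and from the constant [M] up to [cl], the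
    second run backwards. *)
Lemma closure_contractible (R : realType) (T : finType) (le : rel T)
    (P : {set T}) (cl : T -> T) (M : T) :
  reflexive le -> antisymmetric le -> transitive le ->
  M \in P -> {in P, forall v, cl v \in P} ->
  {in P &, {homo cl : u v / le u v}} ->
  {in P, forall v, le v (cl v)} -> {in P, forall v, le M (cl v)} ->
  contractible R (realisation R (order_complex le P)).
Proof.
move=> le_refl le_anti le_trans MP clP cl_homo le_cl le_M.
have mem_cl := @pushforward_monotone R _ _ le le P P cl clP cl_homo.
have mem_M : realisation_set (order_complex le P)
    (pushforward (fun=> M) (fun _ : unit => 1 : R)).
  by apply: pushforward_realisation => //=; rewrite ?le_refl //;
    rewrite big_const card_unit /= addr0.
exists (realisation_point mem_M).
apply: (@homotopic_trans _ _ _ _ (fun x => realisation_point (mem_cl x))).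
  apply: (order_homotopic le_anti le_trans (f := id) (g := cl)) => //.
  move=> x; apply/funext => v /=.
  by rewrite /pushforward (big_pred1 v).
apply: homotopic_sym.
apply: (order_homotopic le_anti le_trans (f := fun=> M) (g := cl)) => //.
move=> x; apply/funext => v /=; rewrite /pushforward.
have [_ x1 _] := set_mem (svalP x).
rewrite big_mkcond [RHS]big_mkcond /=; case: (M == v); last by rewrite !big1.
by rewrite x1 big_const card_unit /= addr0.
Qed.

(** * Maps to spheres *)

Section Sphere.
Variables (R : realType) (k : nat).

Definition sqnorm (u : 'I_k.+1 -> R) : R := \sum_i u i ^+ 2.

Lemma sqnorm_gt0 (u : 'I_k.+1 -> R) i : u i != 0 -> 0 < sqnorm u.
Proof.
move=> ui; rewrite /sqnorm (bigD1 i) //= ltr_pwDl //.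
  by rewrite exprn_even_gt0 //= ui orbT.
by apply: sumr_ge0 => j _; exact: sqr_ge0.
Qed.

Lemma normalise_subproof (u : 'I_k.+1 -> R) : 0 < sqnorm u ->
  \sum_i (\row_j (u j / Num.sqrt (sqnorm u)) : 'rV[R]_k.+1) ord0 i ^+ 2 = 1.
Proof.
move=> u0; under eq_bigr => i _ do rewrite mxE expr_div_n sqr_sqrtr ?ltW //.
by rewrite -mulr_suml divff // gt_eqF.
Qed.

Definition normalise (u : 'I_k.+1 -> R) (u0 : 0 < sqnorm u) : sphere R k :=
  exist _ (\row_j (u j / Num.sqrt (sqnorm u)))
    (mem_set (normalise_subproof u0)).

Lemma normalise_continuous (X : topologicalType) (u : X -> 'I_k.+1 -> R)
    (u0 : forall x, 0 < sqnorm (u x)) :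
  (forall i, continuous (fun x => u x i)) ->
  continuous (fun x => normalise (u0 x)).
Proof.
move=> cu; apply: continuous_sphere => i /=.
under eq_fun do rewrite mxE.
have cn : continuous (fun x => Num.sqrt (sqnorm (u x))).
  apply: (@continuousT_comp _ R R (fun x => sqnorm (u x)) Num.sqrt);
    last exact: sqrt_continuous.
  apply: continuous_sum => j _ x.
  by apply: (@cvgM R X) ; exact: cu.
move=> x; apply: cvgM; first exact: cu.
by apply: cvgV; [rewrite gt_eqF // sqrtr_gt0 | exact: cn].
Qed.

(** The segment from [F x] to [G x] avoids the origin and can be projected radially. *)
Lemma sphere_homotopic (X : topologicalType) (F G : X -> sphere R k) :
  continuous F -> continuous G ->
  (forall x t, 0 <= t <= 1 -> exists i,
    (1 - t) * \val (F x) ord0 i + t * \val (G x) ord0 i != 0) ->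
  homotopic R F G.
Proof.
move=> cF cG FG.
have u0 (p : X * R) : 0 < sqnorm (fun i => (1 - clamp p.2) * \val (F p.1) ord0 i
    + clamp p.2 * \val (G p.1) ord0 i).
  by have [i] := FG p.1 _ (clamp_itv p.2); exact: sqnorm_gt0.
have cH : continuous (fun p => normalise (u0 p)).
  apply: normalise_continuous => i.
  have cl : continuous (fun p : X * R => clamp p.2).
    exact: continuousT_comp (@continuousT_snd X R) (@clamp_continuous R).
  have cFv := continuousT_comp (continuousT_comp (@continuousT_fst X R) cF)
    (@sphere_coord_continuous _ _ i).
  have cGv := continuousT_comp (continuousT_comp (@continuousT_fst X R) cG)
    (@sphere_coord_continuous _ _ i).
  move=> p; apply: cvgD; apply: cvgM; [|exact: cFv|exact: cl|exact: cGv].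
  by apply: cvgB; [exact: cvg_cst | exact: cl].
(* Normalising fixes unit vectors, so the projected segment still ends at [F x] and [G x]. *)
have unit_sqnorm (z : sphere R k) : sqnorm (\val z ord0) = 1.
  exact: set_mem (svalP z).
have F0 : (fun x => normalise (u0 (x, 0))) = F.
  apply/funext => x; apply/val_inj/rowP => i /=; rewrite mxE /= clamp_le0 //.
  under [sqnorm _]eq_bigr => j _ do rewrite subr0 mul1r mul0r addr0.
  by rewrite subr0 mul1r mul0r addr0 [\sum_i _]unit_sqnorm sqrtr1 divr1.
have G1 : (fun x => normalise (u0 (x, 1))) = G.
  apply/funext => x; apply/val_inj/rowP => i /=; rewrite mxE /= clamp_ge1 //.
  under [sqnorm _]eq_bigr => j _ do rewrite subrr mul1r mul0r add0r.
  by rewrite subrr mul1r mul0r add0r [\sum_i _]unit_sqnorm sqrtr1 divr1.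
rewrite -[X in homotopic _ X _]F0 -[X in homotopic _ _ X]G1.
exact: continuous_homotopic cH.
Qed.

End Sphere.

(** * Crosscuts by a Boolean lattice *)

Definition nontrivial (I : finType) (S : {set I}) : bool :=
  (S != finset.set0) && (S != finset.setT).

Section BooleanCrosscut.
Variables (R : realType) (T : finType) (le : rel T) (P : {set T}) (k : nat).
Let I : finType := 'I_k.+2.
(** [sigma v] plays the set of coatoms above [v], and [mu S] the meet of [S]. The hypotheses make
    them an antitone Galois connection between [P] and the nontrivial sets, in which every
    nontrivial set is closed. *)
Variables (sigma : T -> {set I}) (mu : {set I} -> T).

Hypotheses (le_anti : antisymmetric le) (le_trans : transitive le).
Hypothesis sigma_nontrivial : {in P, forall v, nontrivial (sigma v)}.
Hypothesis mu_P : forall S, nontrivial S -> mu S \in P.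
Hypothesis sigma_anti : forall u v, le u v -> sigma v \subset sigma u.
Hypothesis mu_anti : forall S S' : {set I}, S \subset S' -> le (mu S') (mu S).
Hypothesis le_mu_sigma : {in P, forall v, le v (mu (sigma v))}.
Hypothesis mu_K : forall S, nontrivial S -> sigma (mu S) = S.

Let X := realisation R (order_complex le P).

Definition coatom_mass (x : T -> R) (i : I) : R :=
  \sum_(v | i \in sigma v) x v.

(** On the chain supporting [x], whatever lies under [b] is below [v], hence under [a]; [v] itself
    counts for [a] only. *)
Lemma coatom_mass_lt (x : X) v a b : \val x v != 0 ->
  a \in sigma v -> b \notin sigma v ->
  coatom_mass (\val x) b < coatom_mass (\val x) a.
Proof.
have [x0 x1 xP xle] := (order_complexP _ _ _).1 (set_mem (svalP x)).
move=> xv av bv; rewrite /coatom_mass [ltRHS](bigD1 v) //=.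
rewrite ltr_pwDl //; first by rewrite lt_neqAle eq_sym xv x0.
rewrite big_mkcond [leRHS]big_mkcond ler_sum // => u _.
case: ifPn => bu; last by case: ifP.
have [->|xu] := eqVneq (sval x u) 0; first by case: ifP.
have neq_uv : u != v by apply: contraNneq bv => <-.
rewrite neq_uv andbT ifT //.
have /orP[/sigma_anti uv|/sigma_anti vu] := xle _ _ xu xv.
  exact: (fintype.subsetP uv).
by have := fintype.subsetP vu _ bu; rewrite (negPf bv).
Qed.

Lemma coatom_mass_continuous i :
  continuous (fun x : X => coatom_mass (\val x) i).
Proof.
by apply: continuous_sum => v _; exact: realisation_coord_continuous.
Qed.

Let mass_diff (x : X) (j : 'I_k.+1) : R :=
  coatom_mass (\val x) (lift ord0 j) - coatom_mass (\val x) ord0.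

(** A vertex of the support lies under some coatom [a] but misses some [b], so the masses are not
    all equal to the one at index 0. *)
Lemma mass_diff_gt0 (x : X) : 0 < sqnorm (mass_diff x).
Proof.
have [v xv] := realisation_support x.
have [x0 x1 xP xle] := (order_complexP _ _ _).1 (set_mem (svalP x)).
have /andP[/set0Pn[a av]] := sigma_nontrivial (xP v xv).
rewrite -finset.subTset => /subsetPn[b _ bv].
have ab := coatom_mass_lt xv av bv.
suff [j xj] : exists j, mass_diff x j != 0 by exact: sqnorm_gt0 xj.
apply/not_existsP => all0.
have mass0 i : coatom_mass (sval x) i = coatom_mass (sval x) ord0.
  case: (unliftP ord0 i) => [j ->|-> //].
  by apply/eqP; rewrite -subr_eq0; apply/negPn/negP/all0.
by move: ab; rewrite (mass0 a) (mass0 b) ltxx.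
Qed.

Definition to_sphere (x : X) : sphere R k := normalise (mass_diff_gt0 x).

Lemma to_sphere_continuous : continuous to_sphere.
Proof.
apply: normalise_continuous => j.
exact: continuousT_sub (@coatom_mass_continuous _) (@coatom_mass_continuous _).
Qed.

(* The sphere lives in R^(k+2) modulo the diagonal; prepending a coordinate 0
   chooses representatives. *)
Definition lift_coord (z : 'rV[R]_k.+1) (i : I) : R :=
  if unlift ord0 i is Some j then z ord0 j else 0.

Lemma lift_coord_continuous i :
  continuous (fun z : sphere R k => lift_coord (\val z) i).
Proof.
rewrite /lift_coord; case: (unlift ord0 i) => [j|].
  exact: sphere_coord_continuous.
exact: continuousT_cst.
Qed.

(** Subtracting the mass at index 0 and dividing by the norm are increasing. Only the order of the
    coordinates matters for the homotopies. *)
Lemma lift_coord_to_sphere (x : X) a b :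
  (lift_coord (\val (to_sphere x)) a < lift_coord (\val (to_sphere x)) b) =
  (coatom_mass (\val x) a < coatom_mass (\val x) b).
Proof.
set r := Num.sqrt (sqnorm (mass_diff x)).
have r0 : 0 < r by rewrite sqrtr_gt0 mass_diff_gt0.
have E i : lift_coord (sval (to_sphere x)) i =
    (coatom_mass (sval x) i - coatom_mass (sval x) ord0) / r.
  rewrite /lift_coord; case: unliftP => [j ->|->] /=; first by rewrite mxE.
  by rewrite subrr mul0r.
by rewrite !E ltr_pM2r ?invr_gt0 // ltrD2r.
Qed.

(** The test excludes the empty and the full set, whose empty products would be 1. *)
Definition gap (y : I -> R) (S : {set I}) : R :=
  if nontrivial S then
    \prod_(a in S) \prod_(b in ~: S) Num.max 0 (y a - y b) else 0.

Lemma gap_ge0 y S : 0 <= gap y S.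
Proof.
rewrite /gap; case: ifP => // _; apply: prodr_ge0 => a _.
by apply: prodr_ge0 => b _; rewrite le_max lexx.
Qed.

Lemma gap_neq0 y S : gap y S != 0 ->
  nontrivial S /\ forall a b, a \in S -> b \notin S -> y b < y a.
Proof.
rewrite /gap; case: ifP => [ntS|]; last by rewrite eqxx.
move=> /prodf_neq0 gS; split=> // a b aS bS.
have /prodf_neq0/(_ b) := gS a aS; rewrite inE => /(_ bS).
by apply: contraNT; rewrite -leNgt => ab; rewrite max_l // subr_le0.
Qed.

(** The set of maximisers of [y] has a positive coefficient; it is proper since it misses [b]. *)
Lemma gap_total_gt0 y a b : y b < y a -> 0 < \sum_S gap y S.
Proof.
move=> ba; pose m := [arg max_(i > a) y i]%O.
have ym i : y i <= y m by rewrite /m; case: arg_maxP => // j _; apply.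
pose S := finset (fun i => y i == y m).
rewrite (bigD1 S) //= ltr_pwDl //; last by apply: sumr_ge0 => *; exact: gap_ge0.
rewrite /gap ifT; last first.
  apply/andP; split; first by apply/set0Pn; exists m; rewrite inE.
  rewrite -finset.subTset; apply/subsetPn; exists b => //.
  by rewrite inE lt_eqF // (lt_le_trans ba).
apply: prodr_gt0 => i; rewrite inE => /eqP ->.
apply: prodr_gt0 => j; rewrite !inE => jm.
by rewrite lt_max ltxx subr_gt0 lt_neqAle jm ym.
Qed.

(** A nonzero coordinate of [z] differs from the prepended 0, so the lifted vector is not
    constant. *)
Lemma sphere_gap_gt0 (z : sphere R k) :
  0 < \sum_S gap (lift_coord (\val z)) S.
Proof.
have z1 : sqnorm (sval z ord0) = 1 by exact: set_mem (svalP z).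
have [j zj] : exists j, sval z ord0 j != 0.
  apply/not_existsP => all0; have := oner_neq0 R; rewrite -z1 /sqnorm.
  rewrite big1 ?eqxx // => j _.
  have /negP/negPn/eqP -> := all0 j; by rewrite expr0n.
have zl : lift_coord (sval z) (lift ord0 j) = sval z ord0 j.
  by rewrite /lift_coord liftK.
have z0 : lift_coord (sval z) ord0 = 0 by rewrite /lift_coord unlift_none.
have [lt0|gt0|eq0] := ltrgtP (sval z ord0 j) 0.
- by apply: (@gap_total_gt0 _ ord0 (lift ord0 j)); rewrite zl z0.
- by apply: (@gap_total_gt0 _ (lift ord0 j) ord0); rewrite zl z0.
- by rewrite eq0 eqxx in zj.
Qed.

Definition sphere_weight (z : sphere R k) (S : {set I}) : R :=
  gap (lift_coord (\val z)) S / \sum_S' gap (lift_coord (\val z)) S'.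

Lemma sphere_weight_neq0 z S : sphere_weight z S != 0 ->
  gap (lift_coord (\val z)) S != 0.
Proof. by apply: contraNneq => g0; rewrite /sphere_weight g0 mul0r. Qed.

Lemma subset_total (S S' : {set I}) :
  (forall a b, a \in S -> a \notin S' -> b \in S' -> b \notin S -> False) ->
  (S \subset S') || (S' \subset S).
Proof.
move=> SS'; apply/orP.
have [|/subsetPn[a aS aS']] := boolP (S \subset S'); first by left.
right; apply/fintype.subsetP => b bS'.
by apply: contraT => bS; case: (SS' a b).
Qed.

Lemma mu_total (S S' : {set I}) : (S \subset S') || (S' \subset S) ->
  le (mu S) (mu S') || le (mu S') (mu S).
Proof. by case/orP => /mu_anti ->; rewrite ?orbT. Qed.

Lemma of_sphere_subproof (z : sphere R k) :
  realisation_set (order_complex le P) (pushforward mu (sphere_weight z)).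
Proof.
apply: pushforward_realisation.
- by move=> S; rewrite divr_ge0 ?gap_ge0 // ltW // sphere_gap_gt0.
- by rewrite -mulr_suml divff // gt_eqF // sphere_gap_gt0.
- by move=> S /sphere_weight_neq0/gap_neq0[/mu_P].
- move=> S S' /sphere_weight_neq0/gap_neq0[_ gS].
  move=> /sphere_weight_neq0/gap_neq0[_ gS'].
  (* Two incomparable level sets would order [a] and [b] both ways. *)
  apply/mu_total/subset_total => a b aS aS' bS' bS.
  by have := lt_trans (gS _ _ aS bS) (gS' _ _ bS' aS'); rewrite ltxx.
Qed.

Definition of_sphere (z : sphere R k) : X :=
  realisation_point (of_sphere_subproof z).

Lemma of_sphere_continuous : continuous of_sphere.
Proof.
have cgap S : continuous (fun z : sphere R k => gap (lift_coord (\val z)) S).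
  rewrite /gap; case: (nontrivial S); last exact: continuousT_cst.
  apply: continuous_prod => a _; apply: continuous_prod => b _.
  apply: continuous_maxr; first exact: continuousT_cst.
  exact: continuousT_sub (@lift_coord_continuous _) (@lift_coord_continuous _).
apply: continuous_realisation => v; apply: continuous_sum => S _.
apply: continuousT_div (cgap S) _ => [z|].
  by rewrite gt_eqF // sphere_gap_gt0.
by apply: continuous_sum => S' _; exact: cgap.
Qed.

(** Let [mu S] be a vertex of the support of [of_sphere z], with [a] in [S] and [b] outside. Then
    [z] has its coordinate at [b] below that at [a], and so has its image under the round trip,
    because [sigma (mu S)] is [S]. Both lie in one open half-space, so the segment between them
    avoids 0. *)
Lemma of_sphereK_homotopic : homotopic R (to_sphere \o of_sphere) idfun.
Proof.
apply: sphere_homotopic.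
- exact: continuousT_comp of_sphere_continuous to_sphere_continuous.
- by move=> z; exact: cvg_id.
move=> z t /andP[t0 t1] /=.
have [v] := realisation_support (of_sphere z).
move=> xv; have [S wS muS] := pushforward_neq0 xv.
have [ntS gS] := gap_neq0 (sphere_weight_neq0 wS).
have /andP[/set0Pn[a aS]] := ntS.
rewrite -finset.subTset => /subsetPn[b _ bS].
have ba := gS a b aS bS.
have ba' : lift_coord (sval (to_sphere (of_sphere z))) b <
           lift_coord (sval (to_sphere (of_sphere z))) a.
  rewrite lift_coord_to_sphere; apply: coatom_mass_lt xv _ _.
    by rewrite -muS mu_K.
  by rewrite -muS mu_K.
set y := sval (to_sphere (of_sphere z)) in ba' *.
apply/not_existsP => all0.
have all0' i : (1 - t) * lift_coord y i + t * lift_coord (sval z) i = 0.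
  rewrite /lift_coord; case: (unlift ord0 i) => [j|].
    by apply/eqP/negPn/negP; exact: all0.
  by rewrite !mulr0 addr0.
have := all0' a; have := all0' b.
move: ba ba'; move: (lift_coord y a) (lift_coord y b).
move: (lift_coord _ a) (lift_coord _ b) => za zb ya yb zba yba eb ea.
have tz : 0 <= t * (za - zb) by rewrite mulr_ge0 // subr_ge0 ltW.
have [t_lt1|t_ge1] := ltP t 1; last by have t_eq1 : t = 1; [lra | nra].
have ty : 0 < (1 - t) * (ya - yb) by rewrite mulr_gt0 // subr_gt0.
nra.
Qed.

(** The closure [mu \o sigma] is the intermediate map: a straight line joins the round trip to it,
    and an order homotopy joins the identity to it. *)
Lemma to_sphereK_homotopic : homotopic R (of_sphere \o to_sphere) idfun.
Proof.
have cl_P : {in P, forall v, mu (sigma v) \in P}.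
  by move=> v vP; apply: mu_P; exact: sigma_nontrivial.
have cl_homo : {in P &, {homo mu \o sigma : u v / le u v}}.
  by move=> u v _ _ uv; apply: mu_anti; exact: sigma_anti.
have mem_cl := @pushforward_monotone R _ _ le le P P (mu \o sigma) cl_P cl_homo.
apply: (@homotopic_trans _ _ _ _ (fun x => realisation_point (mem_cl x))).
  apply: straight_line_homotopic.
  - exact: continuousT_comp to_sphere_continuous of_sphere_continuous.
  - apply: continuous_realisation => v; apply: continuous_sum => u _.
    exact: realisation_coord_continuous.
  - move=> x u v /pushforward_neq0[S wS <-] /pushforward_neq0[w xw <-].
    have [_ gS] := gap_neq0 (sphere_weight_neq0 wS).
    (* [S] is an upper level set of the masses, and [w] in the support makes the masses on [sigma w]
       exceed those off it; hence [S] and [sigma w] are nested. *)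
    apply/mu_total/subset_total => a b aS aw bw bS.
    have := gS a b aS bS; rewrite lift_coord_to_sphere.
    by move=> /lt_trans/(_ (coatom_mass_lt xw bw aw)); rewrite ltxx.
apply: homotopic_sym.
apply: (order_homotopic le_anti le_trans (f := id) (g := mu \o sigma)) => //.
move=> x; apply/funext => v /=.
by rewrite /pushforward (big_pred1 v).
Qed.

Lemma crosscut_sphere : homotopy_equivalent R X (sphere R k).
Proof.
exists to_sphere, of_sphere; split.
- exact: to_sphere_continuous.
- exact: of_sphere_continuous.
- exact: to_sphereK_homotopic.
- exact: of_sphereK_homotopic.
Qed.

End BooleanCrosscut.

End Crosscut.

(** * Coatoms of the lattice of arithmetic progressions *)

Section ArithmeticProgressions.
Set Implicit Arguments.
Unset Strict Implicit.
Unset Printing Implicit Defensive.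

Lemma is_arith_prog_divisible (N lo hi d : nat) (S : {set 'I_N.+1}) :
  0 < d -> lo <= 1 -> hi <= N ->
  (forall x : 'I_N.+1, (x \in S) = [&& lo <= x, x <= hi & d %| x]) ->
  is_arith_prog S.
Proof.
move=> d_gt0 lo1 hiN SE; exists (1 + lo * d), d, ((hi %/ d).+1 - lo).
split=> // m; split=> [[x]|[j jk ->]].
  rewrite SE => /and3P[lox xhi /dvdnP[q xq]] <-; exists (q - lo).
    have : q <= hi %/ d by rewrite leq_divRL // -xq.
    by case: lo lo1 lox {SE} => [|[|lo]] //; case: q xq => [|q] xq *; lia.
  have lo_q : lo <= q.
    by case: lo lo1 lox {SE} => [|[|lo]] //; case: q xq => [|q] xq *; lia.
  by rewrite -addnA -mulnDl subnKC // -xq add1n.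
have jd : (lo + j) * d <= hi by rewrite -leq_divRL //; lia.
have xN : (lo + j) * d < N.+1 by rewrite ltnS (leq_trans jd).
exists (Ordinal xN) => /=; last by rewrite mulnDl; lia.
rewrite SE /= jd dvdn_mull // !andbT.
by case: lo lo1 {SE jd xN jk} => [|[|lo]] //= _; rewrite muln_gt0 d_gt0.
Qed.

(* The coatoms [n] minus {n}, [n] minus {1} and A_p, for n = N.+1; as x : 'I_n
   stands for x.+1, A_p consists of the multiples of p. *)
Definition coatom (N i : nat) : {set 'I_N.+1} :=
  finset (fun x : 'I_N.+1 => match i with
    | 0 => x != N :> nat
    | 1 => x != 0 :> nat
    | j.+2 => nth 1 (primes N) j %| x
    end).

Section Coatoms.
Variable N : nat.
Hypothesis N_gt0 : 0 < N.
Let k := size (primes N).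

Lemma nth_primes j : j < k -> prime (nth 1 (primes N) j) /\
  nth 1 (primes N) j %| N.
Proof. by move=> /(mem_nth 1); rewrite mem_primes => /and3P[]. Qed.

Definition coatom_meet (S : {set 'I_k.+2}) : {set 'I_N.+1} :=
  finset (fun x : 'I_N.+1 => [forall i in S, x \in coatom N i]).

Definition coatoms_above (v : {set 'I_N.+1}) : {set 'I_k.+2} :=
  finset (fun i : 'I_k.+2 => v \subset coatom N i).

(** The meet consists of the multiples of the lcm [d] of the primes selected by [S], without 0 if
    [S] contains index 1 and without [N] if it contains index 0. *)
Lemma is_arith_prog_meet S : is_arith_prog (coatom_meet S).
Proof.
pose i0 : 'I_k.+2 := Ordinal (isT : 0 < k.+2).
pose i1 : 'I_k.+2 := Ordinal (isT : 1 < k.+2).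
pose d := \big[lcmn/1]_(i in S | 1 < i) nth 1 (primes N) i.-2.
have dN : d %| N.
  apply/dvdn_biglcmP => i /andP[_ i_gt1].
  by apply: (nth_primes _).2; have := ltn_ord i; lia.
apply: (@is_arith_prog_divisible N (i1 \in S) (N - (i0 \in S)) d).
- exact: dvdn_gt0 dN.
- by case: (_ \in _).
- exact: leq_subr.
move=> x; rewrite inE; apply/forall_inP/and3P => [xS|[lox xhi dx] i iS].
  split.
  - by case: (boolP (i1 \in S)) => // /xS; rewrite inE lt0n.
  - have xN := ltn_ord x; case: (boolP (i0 \in S)) => [/xS|_] /=; last by lia.
    by rewrite inE /=; lia.
  - apply/dvdn_biglcmP => -[[|[|i]] ik] /andP[] // /xS.
    by rewrite inE.
rewrite inE; case: i iS => -[|[|i]] ik iS /=.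
- have i0S : i0 \in S by rewrite -(_ : Ordinal ik = i0) //; exact: val_inj.
  by move: xhi; rewrite i0S; lia.
- have i1S : i1 \in S by rewrite -(_ : Ordinal ik = i1) //; exact: val_inj.
  by move: lox; rewrite i1S; lia.
- have /dvdn_biglcmP/(_ (Ordinal ik)) := dx.
  by rewrite /= iS => ->.
Qed.

Lemma proper_arith_progsP v : v \in proper_arith_progs N.+1 <->
  [/\ is_arith_prog v, v != finset.set0 & v != finset.setT].
Proof.
rewrite !inE negb_or; split=> [/andP[/andP[-> ->] /asboolP]//|].
by case=> /asboolP -> -> ->.
Qed.

(** A progression missing an end of [n] lies in one of the first two coatoms. One containing both
    ends has a step [r] dividing [N], and [r] is not 1 as the progression is proper; a prime factor
    of [r] gives the coatom. *)
Lemma sub_coatom v : v \in proper_arith_progs N.+1 ->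
  exists i : 'I_k.+2, v \subset coatom N i.
Proof.
move=> /proper_arith_progsP[[a [r [l [r_gt0 vE]]]] v0 vT].
have [Nv|Nv] := boolP (ord_max \in v); last first.
  exists (@Ordinal k.+2 0 isT); apply/fintype.subsetP => x xv; rewrite inE /=.
  by apply: contraNneq Nv => xN; rewrite -(_ : x = ord_max) //; apply: val_inj.
have [zv|zv] := boolP (ord0 \in v); last first.
  exists (@Ordinal k.+2 1 isT); apply/fintype.subsetP => x xv; rewrite inE /=.
  by apply: contraNneq zv => x0; rewrite -(_ : x = ord0) //; apply: val_inj.
have [j0 j0l /= ej0] := (vE 1).1 (ex_intro2 _ _ ord0 zv erefl).
have [j1 j1l /= ej1] := (vE N.+1).1 (ex_intro2 _ _ ord_max Nv erefl).
(* The first term lies in [n], so it is at least 1, while 1 is one of the terms. *)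
have a1 : a = 1.
  have l_gt0 : 0 < l by lia.
  have [x _ ex] := (vE a).2 (ex_intro2 _ _ 0 l_gt0 (esym (addn0 a))).
  by lia.
have rv x : x \in v -> r %| x.
  move=> xv; have [j _ ej] := (vE x.+1).1 (ex_intro2 _ _ x xv erefl).
  by apply/dvdnP; exists j; lia.
have r_neq1 : r != 1.
  apply: contraNneq vT => r1; rewrite -finset.subTset.
  apply/fintype.subsetP => x _.
  have xl : x < l by have := ltn_ord x; lia.
  have e : x.+1 = a + x * r by lia.
  have [y yv [yx]] := (vE x.+1).2 (ex_intro2 _ _ (x : nat) xl e).
  by rewrite -(_ : y = x) //; apply: val_inj.
have r_gt1 : 1 < r by lia.
have rN : r %| N := rv _ Nv.
have pN : pdiv r \in primes N.
  by rewrite mem_primes pdiv_prime // N_gt0 (dvdn_trans (pdiv_dvd r)).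
have ik : (index (pdiv r) (primes N)).+2 < k.+2 by rewrite !ltnS index_mem.
exists (Ordinal ik); apply/fintype.subsetP => x /rv rx; rewrite inE /=.
by rewrite nth_index // (dvdn_trans (pdiv_dvd r)).
Qed.

Lemma coatom_proper (i : 'I_k.+2) : exists x, x \notin coatom N i.
Proof.
case: i => -[|[|i]] ik.
- by exists ord_max; rewrite inE /= eqxx.
- by exists ord0; rewrite inE.
- have [p_pr _] := nth_primes (ik : i < k).
  exists (inord 1); rewrite inE /= inordK //.
  by rewrite dvdn1; apply: contraTneq p_pr => ->.
Qed.

Lemma coatom_meet_proper (S : {set 'I_k.+2}) x :
  S != finset.set0 -> x \in coatom_meet S ->
  coatom_meet S \in proper_arith_progs N.+1.
Proof.
move=> /set0Pn[i iS] xS; apply/proper_arith_progsP; split.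
- exact: is_arith_prog_meet.
- by apply/set0Pn; exists x.
- have [y yi] := coatom_proper i; rewrite -finset.subTset.
  apply/subsetPn; exists y => //; rewrite inE.
  by apply: contra yi => /forall_inP; apply.
Qed.

Lemma coatom_meet_sub (S : {set 'I_k.+2}) i :
  i \in S -> coatom_meet S \subset coatom N i.
Proof.
move=> iS; apply/fintype.subsetP => x; rewrite inE => /forall_inP; exact.
Qed.

Lemma coatom_meet_anti (S S' : {set 'I_k.+2}) :
  S \subset S' -> coatom_meet S' \subset coatom_meet S.
Proof.
move=> /fintype.subsetP SS'; apply/fintype.subsetP => x.
by rewrite !inE => /forall_inP xS'; apply/forall_inP => i /SS'/xS'.
Qed.

Lemma coatoms_above_anti (u v : {set 'I_N.+1}) :
  u \subset v -> coatoms_above v \subset coatoms_above u.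
Proof.
move=> uv; apply/fintype.subsetP => i; rewrite !inE.
exact: fintype.subset_trans.
Qed.

Lemma sub_meet_coatoms_above (v : {set 'I_N.+1}) :
  v \subset coatom_meet (coatoms_above v).
Proof.
apply/fintype.subsetP => x xv; rewrite inE; apply/forall_inP => i.
by rewrite inE => /fintype.subsetP; apply.
Qed.

Lemma coatoms_above_neq0 v : v \in proper_arith_progs N.+1 ->
  coatoms_above v != finset.set0.
Proof.
by move=> /sub_coatom[i vi]; apply/set0Pn; exists i; rewrite inE.
Qed.

(** * Divisors of [N] and common points of coatoms *)

Lemma dvdn_div_other p q : prime p -> prime q -> p %| N -> q %| N -> q != p ->
  q %| N %/ p.
Proof.
move=> p_pr q_pr pN qN neq_qp; rewrite -(@Gauss_dvdl _ _ p).
  by rewrite divnK.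
by rewrite prime_coprime // dvdn_prime2.
Qed.

Lemma div_prime_bounds p : prime p -> p %| N -> 0 < N %/ p < N.
Proof.
move=> p_pr pN; rewrite divn_gt0 ?prime_gt0 // dvdn_leq //=.
by rewrite ltn_Pdiv // prime_gt1.
Qed.

(** The prime-power parts of a squarefree [N] are the primes themselves. *)
Lemma squarefree_dvdn x : squarefree N ->
  (forall p, p \in primes N -> p %| x) -> N %| x.
Proof.
move=> sqf px; apply/dvdn_partP => // p; rewrite p_part => pN.
have [p_pr _ _] := and3P (etrans (esym (mem_primes p N)) pN).
have : logn p N <= 1.
  rewrite leqNgt; apply/negP; rewrite -pfactor_dvdn // => /sqf p1.
  by rewrite p1 in p_pr.
by case: logn => [|[|//]] _; rewrite ?expn0 ?dvd1n // expn1 px.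
Qed.

(** The witnesses are [N] for index 0, 0 for index 1, and [N %/ p] for the coatom of [p];
    squarefreeness is what keeps [p] from dividing [N %/ p]. *)
Lemma coatoms_irredundant (i : 'I_k.+2) : squarefree N ->
  exists2 x, x \notin coatom N i &
    forall j : 'I_k.+2, j != i -> x \in coatom N j.
Proof.
move=> sqf; case: i => -[|[|i]] ik.
- exists ord_max; first by rewrite inE /= eqxx.
  move=> [[|[|j]] jk] //= _; rewrite inE /=; first by lia.
  exact: (nth_primes (jk : j < k)).2.
- exists ord0; first by rewrite inE.
  by move=> [[|[|j]] jk] //= _; rewrite inE /= ?dvdn0 //; lia.
have [p_pr pN] := nth_primes (ik : i < k).
have /andP[x_gt0 xN] := div_prime_bounds p_pr pN.
set p := nth _ _ _ in p_pr pN x_gt0 xN.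
have xE : nat_of_ord (inord (N %/ p) : 'I_N.+1) = N %/ p.
  by rewrite inordK // ltnS ltnW.
exists (inord (N %/ p)).
  rewrite inE xE -/p; apply/negP => ppN.
  have p1 : p = 1.
    by apply: sqf; rewrite expnS expn1 -(divnK pN) dvdn_pmul2r ?prime_gt0.
  by rewrite p1 in p_pr.
move=> [[|[|j]] jk] neq_ji; rewrite inE /= xE; [by lia|by lia|].
have [q_pr qN] := nth_primes (jk : j < k).
apply: dvdn_div_other => //.
by rewrite nth_uniq ?primes_uniq //; apply: contra neq_ji => /eqP ->.
Qed.

(** If the square of a prime [p] divides [N], then [N %/ p] lies strictly between 0 and [N] and is
    still divisible by every prime factor of [N]. *)
Lemma coatoms_common : ~ squarefree N ->
  exists x, forall i : 'I_k.+2, x \in coatom N i.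
Proof.
move=> nsqf; have [d d2N d_neq1] : exists2 d, d ^ 2 %| N & d != 1.
  apply: contrapT => nd; apply: nsqf => d d2N; apply/eqP.
  by apply: contraT => d_neq1; case: nd; exists d.
have d_gt0 : 0 < d.
  by case: d d2N {d_neq1} => // ; rewrite dvd0n; lia.
have d_gt1 : 1 < d by lia.
have p_pr := pdiv_prime d_gt1; set p := pdiv d in p_pr.
have p2N : p ^ 2 %| N := dvdn_trans (dvdn_exp2r 2 (pdiv_dvd d)) d2N.
have pN : p %| N by apply: dvdn_trans p2N; rewrite expnS dvdn_mulr.
have /andP[x_gt0 xN] := div_prime_bounds p_pr pN.
exists (inord (N %/ p)) => -[[|[|j]] jk];
  rewrite inE /= inordK ?ltnS ?(ltnW xN) //; [by lia|by lia|].
have [q_pr qN] := nth_primes (jk : j < k).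
have [->|neq_qp] := eqVneq (nth 1 (primes N) j) p; last exact: dvdn_div_other.
by rewrite -(@dvdn_pmul2r p) ?prime_gt0 // divnK // mulnn.
Qed.

(** * Homotopy type of the order complex *)

Lemma Delta_contractible (R : realType) :
  ~ squarefree N -> contractible R (realisation R (Delta N.+1)).
Proof.
move=> /coatoms_common[x xi].
have x_meet S : x \in coatom_meet S by rewrite inE; apply/forall_inP.
apply: (@closure_contractible R _ _ _
  (coatom_meet \o coatoms_above) (coatom_meet finset.setT)) => //.
- by move=> u v /andP[uv vu]; apply/eqP; rewrite finset.eqEsubset uv.
- by move=> v u w; exact: fintype.subset_trans.
- apply: coatom_meet_proper (x_meet _).
  by apply/set0Pn; exists ord0; rewrite inE.
- move=> v vP; apply: coatom_meet_proper (x_meet _).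
  exact: coatoms_above_neq0.
- by move=> u v _ _ uv; apply/coatom_meet_anti/coatoms_above_anti.
- by move=> v _; exact: sub_meet_coatoms_above.
- by move=> v _; apply: coatom_meet_anti; exact: finset.subsetT.
Qed.

Lemma Delta_sphere (R : realType) : squarefree N ->
  homotopy_equivalent R (realisation R (Delta N.+1)) (sphere R k).
Proof.
move=> sqf.
have meet_irr (S : {set 'I_k.+2}) i x : i \notin S ->
    (forall j : 'I_k.+2, j != i -> x \in coatom N j) -> x \in coatom_meet S.
  move=> iS xi; rewrite inE; apply/forall_inP => j jS; apply: xi.
  by apply: contraNneq iS => <-.
apply: (@crosscut_sphere R _ _ _ _ coatoms_above coatom_meet).
- by move=> u v /andP[uv vu]; apply/eqP; rewrite finset.eqEsubset uv.
- by move=> v u w; exact: fintype.subset_trans.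
- move=> v vP; rewrite /nontrivial coatoms_above_neq0 //=.
  apply/negP => /eqP vT.
  (* A point of [v] would be a multiple of every prime factor of [N], hence of [N], yet differ from
     0 and [N]. *)
  have v_sub (i : 'I_k.+2) : v \subset coatom N i.
    by have := finset.in_setT i; rewrite -vT inE.
  have /proper_arith_progsP[_ /set0Pn[x xv] _] := vP.
  have xi i : x \in coatom N (i : 'I_k.+2) := fintype.subsetP (v_sub i) x xv.
  have := xi (@Ordinal k.+2 0 isT); have := xi (@Ordinal k.+2 1 isT).
  rewrite !inE /= => x_neq0 x_neqN.
  have Nx : N %| x.
    apply: squarefree_dvdn => // p pN.
    have ik : (index p (primes N)).+2 < k.+2 by rewrite !ltnS index_mem.
    by have := xi (Ordinal ik); rewrite inE /= nth_index.
  by have := dvdn_leq _ Nx; have := ltn_ord x; lia.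
- move=> S /andP[S_neq0]; rewrite -finset.subTset => /subsetPn[i _ iS].
  have [x _ xi] := coatoms_irredundant i sqf.
  exact: coatom_meet_proper S_neq0 (meet_irr _ _ _ iS xi).
- by move=> u v; exact: coatoms_above_anti.
- by move=> S S'; exact: coatom_meet_anti.
- by move=> v _; exact: sub_meet_coatoms_above.
(* For [i] outside [S], the irredundance witness of [i] lies in the meet of [S] but not in the
   coatom [i]. *)
- move=> S /andP[_ _]; apply/finset.setP => i; rewrite inE.
  have [iS|iS] := boolP (i \in S); first exact: coatom_meet_sub.
  have [x xNi xi] := coatoms_irredundant i sqf.
  by apply/subsetPn; exists x => //; exact: meet_irr iS xi.
Qed.

End Coatoms.
End ArithmeticProgressions.

Theorem theorem12 (R : realType) (n : nat) (hn : 2 <= n) :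
  (~ squarefree n.-1 -> contractible R (realisation R (Delta n))) /\
  (squarefree n.-1 ->
     homotopy_equivalent R (realisation R (Delta n))
       (sphere R (size (primes n.-1)))).
Proof.
case: n hn => [|N] // N_gt0.
by split; [exact: Delta_contractible | exact: Delta_sphere].
Qed.
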